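(* Let $A\in\mathbb{R}^{n\times n}$ be such that $\Lambda_1$ is complex, i.e. the set of eigenvalues of $A$ with maximal real part consists exactly of a pair of simple complex conjugate eigenvalues $\lambda_1,\overline{\lambda_1}$ with $\omega_1=\operatorname{Im}\lambda_1>0$. Let $y_0\in\mathbb{R}^n$ and $\hat z_0\in\mathbb{R}^n$, $\|\hat z_0\|=1$, with $w^{(1)}y_0\neq0$ and $w^{(1)}\hat z_0\neq0$. Then, as $t\to+\infty$, $$K(t,y_0,\hat z_0)\sim \mathrm{OSF}(y_0,\hat z_0)\cdot \mathrm{OT}(t,y_0,\hat z_0),\qquad K(t,y_0)\sim\mathrm{OSF}(y_0)\cdot\mathrm{OT}(t,y_0),$$ where $$\mathrm{OSF}(y_0,\hat z_0)=\frac{|\hat w^{(1)}\hat z_0|}{|\hat w^{(1)}\hat y_0|},\quad \mathrm{OSF}(y_0)=\frac{1}{|\hat w^{(1)}\hat y_0|},\quad \mathrm{OT}(t,y_0,\hat z_0)=\frac{\|\hat\Theta_1(t,\hat z_0)\|}{\|\hat\Theta_1(t,\hat y_0)\|},\quad \mathrm{OT}(t,y_0)=\frac{\|\hat\Theta_1(t)\|}{\|\hat\Theta_1(t,\hat y_0)\|}.$$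
   Context: $\|\cdot\|$ is a vector norm on $\mathbb{C}^n$, used on $\mathbb{R}^n$ by restriction; matrix norms of real matrices are induced over real vectors. $\hat y_0=y_0/\|y_0\|$, $K(t,y_0,\hat z_0)=\|e^{tA}\hat z_0\|/\|e^{tA}\hat y_0\|$, $K(t,y_0)=\|e^{tA}\|/\|e^{tA}\hat y_0\|$ (real induced norm). $w^{(1)}$ (complex row) and $v^{(1)}$ (complex column) are left and right eigenvectors of $A$ for $\lambda_1$; $\hat w^{(1)}=w^{(1)}/\|w^{(1)}\|$ with $\|w^{(1)}\|=\max_{u\in\mathbb{C}^n,\|u\|=1}|w^{(1)}u|$, and $\hat v^{(1)}=v^{(1)}/\|v^{(1)}\|$. Write $\hat v^{(1)}_k=|\hat v^{(1)}_k|e^{\sqrt{-1}\alpha_{1k}}$, $\hat w^{(1)}_l=|\hat w^{(1)}_l|e^{\sqrt{-1}\beta_{1l}}$, and for $u\in\mathbb{R}^n$ with $w^{(1)}u\ne0$, $\hat w^{(1)}u=|\hat w^{(1)}u|e^{\sqrt{-1}\gamma_1(u)}$. Define $\hat\Theta_1(t,u)=\big(|\hat v^{(1)}_k|\cos(\omega_1t+\alpha_{1k}+\gamma_1(u))\big)_{k=1}^n\in\mathbb{R}^n$ and $\hat\Theta_1(t)=\big(|\hat v^{(1)}_k||\hat w^{(1)}_l|\cos(\omega_1t+\alpha_{1k}+\beta_{1l})\big)_{k,l=1}^n\in\mathbb{R}^{n\times n}$. $a(t)\sim b(t)$ means $a(t)/b(t)\to1$ as $t\to+\infty$.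
   Formalization: The eigenvectors are assumed normalized by w^{(1)}v^{(1)}=1; for arbitrary eigenvectors a non-real phase of w^{(1)}v^{(1)} shifts time in the oscillating terms and the claim fails (e.g. plane rotation with the sup norm). *)

(* Defs.v *)
From HB Require Import structures.
From mathcomp Require Import all_boot all_order all_algebra.
From mathcomp Require Import all_classical all_reals all_analysis.
From mathcomp Require Import complex.
Set Implicit Arguments. Unset Strict Implicit. Unset Printing Implicit Defensive.
Import Order.TTheory GRing.Theory Num.Theory numFieldNormedType.Exports.
Local Open Scope ring_scope.
Local Open Scope classical_set_scope.

Section Defs.
Variable R : realType.
Variable n : nat.
Local Notation C := R[i].

Definition cvec (u : 'cV[R]_n) : 'cV[C]_n := map_mx (real_complex R) u.
Definition cmx (A : 'M[R]_n) : 'M[C]_n := map_mx (real_complex R) A.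

Definition cabs (z : C) : R := complex.Re `|z|.

Definition expi (a : R) : C := (cos a +i* sin a)%C.

Definition is_vnorm (N : 'cV[C]_n -> R) : Prop :=
  [/\ forall x, 0 <= N x,
      forall x, N x = 0 -> x = 0,
      forall (c : C) x, N (c *: x) = cabs c * N x
    & forall x y, N (x + y) <= N x + N y].

Definition rnorm (N : 'cV[C]_n -> R) (u : 'cV[R]_n) : R := N (cvec u).

Definition mnorm (N : 'cV[C]_n -> R) (M : 'M[R]_n) : R :=
  sup [set rnorm N (M *m u) | u in [set u : 'cV[R]_n | rnorm N u = 1]].

Definition rownorm (N : 'cV[C]_n -> R) (w : 'rV[C]_n) : R :=
  sup [set cabs ((w *m u) 0 0) | u in [set u : 'cV[C]_n | N u = 1]].

Definition expmx (t : R) (A : 'M[R]_n) : 'M[R]_n :=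
  \matrix_(i, j) limn (series (fun k => t ^+ k / (k`!)%:R * (A ^+ k) i j)).

(** \hat Theta_1(t,u) given the phases alpha_k of \hat v_k and gamma_1(u) *)
Definition Theta_vec (om : R) (vh : 'cV[C]_n) (alpha : 'I_n -> R) (g : R)
  (t : R) : 'cV[R]_n :=
  \col_k (cabs (vh k 0) * cos (om * t + alpha k + g)).

Definition Theta_mx (om : R) (vh : 'cV[C]_n) (wh : 'rV[C]_n)
  (alpha beta : 'I_n -> R) (t : R) : 'M[R]_n :=
  \matrix_(k, l) (cabs (vh k 0) * cabs (wh 0 l) * cos (om * t + alpha k + beta l)).

End Defs.

Definition asym_equiv (R : realType) (a b : R -> R) : Prop :=
  (fun t => a t / b t) x @[x --> +oo] --> (1 : R).

(* Main.v *)
Require Import Defs.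
From HB Require Import structures.
From mathcomp Require Import all_boot all_order all_algebra.
From mathcomp Require Import all_classical all_reals all_analysis.
From mathcomp Require Import complex.
From mathcomp Require Import ring lra.
Import Order.TTheory GRing.Theory Num.Theory numFieldNormedType.Exports.
Local Open Scope ring_scope.
Set Implicit Arguments.
Unset Strict Implicit.
Unset Printing Implicit Defensive.

(* Write e^{tA} = e^{t Re l1} X(t) + G(t), where X(t) = 2 Re(e^{i om t} v1 w1) is
   the contribution of the pair l1, conj l1. Each column x of G solves x' = A x,
   and w1 x = 0 because w1 x solves a scalar linear equation with initial value
   0. Hence x also solves x' = B x, where B is A with l1, conj l1 moved to
   Re l1 - 1 by two rank-one deflations; since l1, conj l1 are simple, every
   eigenvalue of B has real part < Re l1. Factoring the Cayley-Hamilton relation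
   for B and applying a Gronwall estimate to |p x|^2 for each factor gives
   e^{- t Re l1} x -> 0.

   So e^{- t Re l1} times the norms of e^{tA} u and e^{tA} differ from the norms
   of X(t) u and X(t) by o(1). These stay away from 0 because w1 conj(v1) = 0
   yields |w1 X(t) u| = |w1 u|, so the differences turn into asymptotic
   equivalences. Finally X(t) u and X(t) are multiples of the Theta's. *)

(** * Deflation of an eigenvalue *)

(** Two block eliminations of the matrix [M] with blocks a, v, - w, 1: one gives the left
    determinant, the other multiplies [det M] by a and leaves a block triangular matrix. Keeping the
    factor a avoids any division. *)
Lemma det_scalar_add_rank1 (K : comNzRingType) (n : nat) (a : K)
    (v : 'cV[K]_n) (w : 'rV[K]_n) :
  a * \det (a%:M + v *m w) = a ^+ n * (a + (w *m v) 0 0).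
Proof.
pose M := block_mx a%:M v (- w) (1%:M : 'M[K]_1).
have detM : \det M = \det (a%:M + v *m w).
  have : M *m block_mx 1%:M 0 w 1%:M = block_mx (a%:M + v *m w) v 0 1%:M.
    by rewrite mulmx_block !mulmx1 !mulmx0 mul1mx addNr !add0r.
  move/(congr1 determinant); rewrite det_mulmx det_lblock det_ublock.
  by rewrite !det1 !mulr1.
have : block_mx 1%:M 0 w (a%:M : 'M[K]_1) *m M = block_mx a%:M v 0 (w *m v + a%:M).
  rewrite mulmx_block !mul1mx !mul0mx !addr0 mulmx1 mul_mx_scalar mul_scalar_mx.
  by rewrite scalerN subrr.
move/(congr1 determinant); rewrite det_mulmx det_lblock det_ublock.
rewrite !det_scalar expr1 expr1n mul1r detM => ->.
rewrite [w *m v + _]mx11_scalar det_scalar1 [in RHS]addrC.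
by rewrite mxE [a%:M 0 0]mxE eqxx mulr1n.
Qed.

(** Since (X - A) v = q v with q = X - l, one has q (X - A + s v w) = (X - A) (q + s v w). Taking
    determinants, the rank-one formula applies and q ^ n cancels. *)
Lemma char_poly_deflation (K : idomainType) (n : nat) (A : 'M[K]_n)
    (v : 'cV[K]_n) (w : 'rV[K]_n) (l s : K) :
  A *m v = l *: v -> (w *m v) 0 0 = 1 ->
  char_poly (A - s *: (v *m w)) * ('X - l%:P)
    = char_poly A * ('X - (l - s)%:P).
Proof.
move=> Av wv; set q := 'X - l%:P.
have q0 : q ^+ n != 0 by rewrite expf_neq0 // polyXsubC_eq0.
set vP := map_mx polyC v; set wP := map_mx polyC w.
have AvP : map_mx polyC A *m vP = l%:P *: vP by rewrite -map_mxM Av map_mxZ.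
have BE : q *: char_poly_mx (A - s *: (v *m w))
    = char_poly_mx A *m (q%:M + (s%:P *: vP) *m wP).
  rewrite /char_poly_mx map_mxB map_mxZ map_mxM /= -/vP -/wP mulmxDr mul_mx_scalar.
  rewrite mulmxA -scalemxAr mulmxBl AvP mul_scalar_mx -scalerBl -/q.
  rewrite opprB addrA addrAC scalerDr; congr (_ + _).
  by rewrite -!scalemxAl !scalerA mulrC.
have detB := congr1 determinant BE.
rewrite detZ det_mulmx in detB.
have := det_scalar_add_rank1 q (s%:P *: vP) wP.
rewrite -scalemxAr -map_mxM mxE [map_mx _ _ _ _]mxE wv => detD.
apply: (mulfI q0); rewrite mulrA detB -mulrA [_ * q]mulrC detD mulrCA.
by rewrite /char_poly /q polyCB mulr1 opprB addrA addrAC.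
Qed.

(** * Linear differential equations *)

(** The gap e between the homogeneous rate s - e and the forcing rate s keeps the bound free of a
    factor t. With the integrating factor and the forced part removed, [psi] is nonincreasing. *)
Lemma gronwall_exp (R : realType) (S dS : R -> R) (s e C : R) :
  (forall t : R, is_derive t 1 S (dS t)) -> 0 < e -> 0 <= C -> 0 <= S 0 ->
  (forall t : R, 0 <= t -> dS t <= (s - e) * S t + C * expR (s * t)) ->
  forall t : R, 0 <= t -> S t <= (S 0 + C / e) * expR (s * t).
Proof.
move=> dSE e0 C0 S0 dSle t t0.
pose psi := (fun x : R => expR ((e - s) * x) * S x - C / e * expR (e * x)).
pose dpsi (x : R) := expR ((e - s) * x) * (dS x - (s - e) * S x) - C * expR (e * x).
have dpsiE (x : R) : is_derive x 1 psi (dpsi x).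
  have dSx := dSE x.
  apply: is_derive_eq; rewrite /dpsi /GRing.scale /=.
  by field; rewrite gt_eqF.
have dpsi_le (x : R) : 0 <= x -> dpsi x <= 0.
  move=> x0; rewrite subr_le0.
  have -> : C * expR (e * x) = expR ((e - s) * x) * (C * expR (s * x)).
    by rewrite mulrCA -expRD; congr (_ * expR _); ring.
  by rewrite ler_pM2l ?expR_gt0 // lerBlDl; exact: dSle.
have : psi t <= psi 0.
  have dpsi_ex x : derivable psi x 1 := @ex_derive _ _ _ _ _ _ _ (dpsiE x).
  apply: (@ler0_derive1_nincry _ psi 0 _ _ _ 0 t) => // [x|].
    rewrite in_itv /= andbT => /ltW x0.
    by rewrite derive1E (@derive_val _ _ _ _ _ _ _ (dpsiE x)) dpsi_le.
  apply: continuous_subspaceT => x.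
  exact/differentiable_continuous/derivable1_diffP.
rewrite /psi !mulr0 expR0 mul1r mulr1 => psile.
rewrite -(ler_pM2l (expR_gt0 ((e - s) * t))).
have -> : expR ((e - s) * t) * ((S 0 + C / e) * expR (s * t))
    = (S 0 + C / e) * expR (e * t).
  by rewrite mulrCA -expRD; congr (_ * expR _); ring.
move: psile; rewrite lerBlDr => /le_trans; apply.
(* It remains to drop the negative constant - C / e and to use S 0 >= 0 with exp (e t) >= 1. *)
rewrite mulrDl lerD2r.
have : 1 <= expR (e * t) by rewrite -expR0 ler_expR mulr_ge0 // ltW.
move=> /(ler_wpM2l S0); rewrite mulr1; apply: le_trans.
by rewrite lerBlDr lerDl divr_ge0 // ltW.
Qed.

Section complex_modulus.
Variable R : realType.
Implicit Types z u : R[i].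

(** Unlike the modulus, its square is differentiable at 0 too, so it can enter a differential
    inequality. *)
Definition csq z : R := complex.Re z ^+ 2 + complex.Im z ^+ 2.

Lemma csq_ge0 z : 0 <= csq z. Proof. by rewrite addr_ge0 ?sqr_ge0. Qed.

Lemma cabsE z : cabs z = Num.sqrt (csq z).
Proof. by rewrite /cabs normc_def. Qed.

Lemma cabs_ge0 z : 0 <= cabs z. Proof. by rewrite cabsE sqrtr_ge0. Qed.

Lemma cabsM z u : cabs (z * u) = cabs z * cabs u.
Proof. by rewrite /cabs normrM !normc_def /= mul0r subr0. Qed.

Lemma cabs_le_add z u : cabs (z + u) <= cabs z + cabs u.
Proof.
by have := ler_normD z u; rewrite /cabs !normc_def -rmorphD /= lecR.
Qed.

Lemma cabs0 : cabs (0 : R[i]) = 0. Proof. by rewrite /cabs normr0. Qed.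

Lemma cabs_eq0 z : (cabs z == 0) = (z == 0).
Proof. by rewrite -[RHS]normr_eq0 /cabs normc_def eq_complex /= eqxx andbT. Qed.

Lemma cabs_real (x : R) : cabs x%:C%C = `|x|.
Proof. by rewrite cabsE /csq /= expr0n addr0 sqrtr_sqr. Qed.

Lemma cabs_expi (a : R) : cabs (expi a) = 1.
Proof. by rewrite cabsE /csq /= cos2Dsin2 sqrtr1. Qed.

Lemma cabs_le_Re_Im z : cabs z <= `|complex.Re z| + `|complex.Im z|.
Proof.
rewrite cabsE -[leRHS]ger0_norm ?addr_ge0 // -sqrtr_sqr ler_wsqrtr //.
rewrite /csq sqrrD !real_normK ?num_real //.
by rewrite lerD2r lerDl mulrn_wge0 // mulr_ge0.
Qed.

Lemma csq0P z : csq z <= 0 -> z = 0.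
Proof.
move=> z0; apply/eqP; rewrite -cabs_eq0 cabsE sqrtr_eq0 //.
Qed.

Lemma ReD z u : complex.Re (z + u) = complex.Re z + complex.Re u.
Proof. by case: z; case: u. Qed.

Lemma ImD z u : complex.Im (z + u) = complex.Im z + complex.Im u.
Proof. by case: z; case: u. Qed.

Lemma Re_sum (I : Type) (r : seq I) (P : pred I) (F : I -> R[i]) :
  complex.Re (\sum_(i <- r | P i) F i) = \sum_(i <- r | P i) complex.Re (F i).
Proof. exact: (big_morph _ ReD). Qed.

Lemma Im_sum (I : Type) (r : seq I) (P : pred I) (F : I -> R[i]) :
  complex.Im (\sum_(i <- r | P i) F i) = \sum_(i <- r | P i) complex.Im (F i).
Proof. exact: (big_morph _ ImD). Qed.

Lemma ReMr z (x : R) : complex.Re (z * x%:C%C) = complex.Re z * x.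
Proof. by case: z => a b /=; rewrite mulr0 subr0. Qed.

Lemma ImMr z (x : R) : complex.Im (z * x%:C%C) = complex.Im z * x.
Proof. by case: z => a b /=; rewrite mulr0 add0r. Qed.

End complex_modulus.

Definition ode_sol (R : realType) (n : nat) (A : 'M[R]_n) (x : R -> 'cV[R]_n) :=
  forall (t : R) i, is_derive t 1 (fun t => x t i 0) ((A *m x t) i 0).

Section linear_ode.
Variables (R : realType) (n : nat) (A : 'M[R]_n) (x : R -> 'cV[R]_n).
Hypothesis odex : ode_sol A x.
Implicit Types p : 'rV[R[i]]_n.

Let ev p (t : R) : R[i] := (p *m cvec (x t)) 0 0.

Let ReE p (u : 'cV[R]_n) :
  complex.Re ((p *m cvec u) 0 0) = \sum_k complex.Re (p 0 k) * u k 0.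
Proof. by rewrite mxE Re_sum; apply: eq_bigr => k _; rewrite mxE ReMr. Qed.

Let ImE p (u : 'cV[R]_n) :
  complex.Im ((p *m cvec u) 0 0) = \sum_k complex.Im (p 0 k) * u k 0.
Proof. by rewrite mxE Im_sum; apply: eq_bigr => k _; rewrite mxE ImMr. Qed.

Let is_derive_lin (c : 'I_n -> R) (t : R) :
  is_derive t 1 (fun t => \sum_k c k * x t k 0) (\sum_k c k * (A *m x t) k 0).
Proof.
have -> : (fun t => \sum_k c k * x t k 0) = \sum_k (fun t => c k * x t k 0).
  by apply/funext => s; rewrite fct_sumE.
apply: is_derive_sum => k; have dx := odex t k.
by apply: is_derive_eq; rewrite ?scaler0 ?addr0.
Qed.

Let csq_ev_derive p (t : R) :
  let dg := (p *m cvec (A *m x t)) 0 0 in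
  is_derive t 1 (fun t => csq (ev p t))
    (2 * (complex.Re (ev p t) * complex.Re dg
          + complex.Im (ev p t) * complex.Im dg)).
Proof.
move=> dg; rewrite /dg /ev ReE ImE ReE ImE.
have -> : (fun t => csq ((p *m cvec (x t)) 0 0)) =
    (fun t => (\sum_k complex.Re (p 0 k) * x t k 0) ^+ 2
              + (\sum_k complex.Im (p 0 k) * x t k 0) ^+ 2).
  by apply/funext => s; rewrite /csq ReE ImE.
have dR := is_derive_lin (fun k => complex.Re (p 0 k)) t.
have dI := is_derive_lin (fun k => complex.Im (p 0 k)) t.
apply: is_derive_eq; rewrite /GRing.scale /=; ring.
Qed.

(* Young's inequality absorbs the forcing term p' x into a slack e of the
   growth rate 2 Re mu. *)
Lemma ode_row_bound (p p' : 'rV[R[i]]_n) (mu : R[i]) (s e C : R) :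
  (forall t : R, 0 <= t ->
    (p *m cvec (A *m x t)) 0 0 = mu * ev p t + ev p' t) ->
  0 < e -> 0 <= C -> 2 * complex.Re mu <= s - 2 * e ->
  (forall t : R, 0 <= t -> csq (ev p' t) <= C * expR (s * t)) ->
  forall t : R, 0 <= t ->
    csq (ev p t) <= (csq (ev p 0) + C / e / e) * expR (s * t).
Proof.
move=> pA e0 C0 mus p'le.
(* Of the slack 2 e, one e pays for Young's inequality and the other is the gap in
   [gronwall_exp]. *)
apply: (@gronwall_exp _ _ _ s e (C / e) (csq_ev_derive p)) => //.
- by rewrite divr_ge0 // ltW.
- exact: csq_ge0.
move=> t t0; rewrite pA //.
have : e^-1 * csq (ev p' t) <= e^-1 * (C * expR (s * t)).
  by rewrite ler_pM2l ?invr_gt0 //; exact: p'le.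
have := csq_ge0 (ev p t); rewrite mulrA [e^-1 * C]mulrC /csq.
case: (ev p t) => a b; case: (ev p' t) => h k; case: mu mus {pA} => m1 m2 /=.
move=> mus S0; set Y := C / e * _ => hk.
have young (y z : R) : 2 * y * z <= e * y ^+ 2 + e^-1 * z ^+ 2.
  have : 0 <= e^-1 * (e * y - z) ^+ 2 by rewrite mulr_ge0 ?sqr_ge0 ?invr_ge0 ?ltW.
  have -> : e^-1 * (e * y - z) ^+ 2 = e * y ^+ 2 + e^-1 * z ^+ 2 - 2 * y * z.
    by field; rewrite gt_eqF.
  by rewrite subr_ge0.
have := young a h; have := young b k.
have : 2 * m1 * (a ^+ 2 + b ^+ 2) <= (s - 2 * e) * (a ^+ 2 + b ^+ 2).
  exact: ler_wpM2r.
move: hk; lra.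
Qed.

End linear_ode.

(** * Decay of solutions governed by a matrix with spectrum left of Re = r *)

Section decay.
Variable R : realType.
Local Open Scope classical_set_scope.

Lemma expR_cvg0 (a : R) : a < 0 -> expR (a * t) @[t --> +oo] --> 0.
Proof.
move=> a0; have -> : (fun t => expR (a * t)) = (fun t => expR (- t)) \o *%R (- a).
  by apply/funext => t /=; rewrite mulNr opprK.
apply: cvg_comp (@cvgr_expR R).
by apply: gt0_cvgMry; [rewrite oppr_gt0|exact: cvg_id].
Qed.

(** A finite list leaves room for one rate below 2 r; the factor 2 appears because s will bound
    squared moduli. *)
Lemma seq_uniform_gap (r : R) (sq : seq R[i]) :
  (forall mu, mu \in sq -> complex.Re mu < r) ->
  exists2 s, s < 2 * r & forall mu, mu \in sq -> 2 * complex.Re mu < s.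
Proof.
elim: sq => [|mu sq IH] H; first by exists (2 * r - 1) => //; lra.
have [|s sr Hs] := IH; first by move=> z zs; apply: H; rewrite inE zs orbT.
have mur : complex.Re mu < r by apply: H; rewrite inE eqxx.
exists (Num.max s (complex.Re mu + r)) => [|z].
  by rewrite gt_max sr /=; lra.
rewrite inE lt_max => /orP[/eqP ->|/Hs -> //].
by apply/orP; right; lra.
Qed.

Variables (n : nat) (A : 'M[R]_n.+1) (x : R -> 'cV[R]_n.+1).
Variables (B : 'M[R[i]]_n.+1) (r : R).
Hypothesis odex : ode_sol A x.
Hypothesis BxE : forall t : R, 0 <= t -> B *m cvec (x t) = cvec (A *m x t).
Hypothesis rootB : forall mu, root (char_poly B) mu -> complex.Re mu < r.

(* Peeling off one factor B - mu of the annihilating polynomial at a time. *)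
Lemma ode_row_decay : exists2 s, s < 2 * r &
  forall p : 'rV[R[i]]_n.+1, exists2 C, 0 <= C &
    forall t, 0 <= t -> csq ((p *m cvec (x t)) 0 0) <= C * expR (s * t).
Proof.
have [sq chE] := closed_field_poly_normal (char_poly B).
rewrite (monicP (char_poly_monic B)) scale1r in chE.
have [|s sr sqs] := @seq_uniform_gap r sq.
  by move=> mu musq; apply: rootB; rewrite chE root_prod_XsubC.
exists s => // p.
(* The induction runs over all rows annihilated by the product of the remaining factors;
   Cayley-Hamilton puts every row in this position at the start. *)
have : p *m horner_mx B (\prod_(z <- sq) ('X - z%:P)) = 0.
  by rewrite -chE Cayley_Hamilton mulmx0.
elim: sq sqs p {chE} => [|mu sq IH] sqs p.
  rewrite big_nil rmorph1 mulmx1 => ->; exists 0 => // t t0.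
  by rewrite mul0mx mxE mul0r /csq /= expr0n addr0.
rewrite big_cons rmorphM /= mulmxA => /IH[|C C0 p'le].
  by move=> z zs; apply: sqs; rewrite inE zs orbT.
have mus : 2 * complex.Re mu < s by apply: sqs; rewrite inE eqxx.
(* With p' = p (B - mu), the function y = p x satisfies y' = mu y + p' x, where p' x is bounded by
   induction. The choice of e makes 2 Re mu equal to s - 2 e. *)
set p' := _ *m _ in p'le.
pose e := (s - 2 * complex.Re mu) / 2.
have e0 : 0 < e by rewrite divr_gt0 // subr_gt0.
exists (csq ((p *m cvec (x 0)) 0 0) + C / e / e).
  by rewrite addr_ge0 ?csq_ge0 // (divr_ge0 (divr_ge0 C0 (ltW e0)) (ltW e0)).
apply: (ode_row_bound odex (p' := p') (mu := mu) (s := s) (e := e) (C := C))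
  => // [t t0|].
  rewrite -BxE // mulmxA /p' rmorphB /= horner_mx_X horner_mx_C mulmxBr mulmxBl.
  rewrite mul_mx_scalar -scalemxAl [X in _ = _ + X]mxE [X in _ = _ + (_ + X)]mxE.
  by rewrite [X in _ - X]mxE [RHS]addrC subrK.
by rewrite /e; lra.
Qed.

(** Apply the row estimate to a unit row; the square root halves the rate to s / 2 < r. *)
Lemma ode_decay k : expR (- r * t) * x t k 0 @[t --> +oo] --> 0.
Proof.
have [s sr /(_ (delta_mx 0 k))[C C0 HC]] := ode_row_decay.
apply: norm_cvg0.
have bnd : Num.sqrt C * expR ((s / 2 - r) * t) @[t --> +oo] --> 0.
  by rewrite -[0](mulr0 (Num.sqrt C)); apply: cvgMl_tmp; apply: expR_cvg0; lra.
apply: (squeeze_cvgr _ (cvg_cst 0) bnd); near=> t.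
have t0 : 0 <= t by near: t; exact: nbhs_pinfty_ge.
rewrite normr_ge0 /=.
have := HC t t0; rewrite -rowE !mxE /csq /= expr0n addr0 => xC.
rewrite normrM (ger0_norm (expR_ge0 _)).
have -> : expR ((s / 2 - r) * t) = expR (- r * t) * expR (s / 2 * t).
  by rewrite -expRD; congr expR; ring.
rewrite mulrCA ler_pM2l ?expR_gt0 //.
rewrite -(ler_pXn2r (n := 2)) ?nnegrE ?mulr_ge0 ?expR_ge0 ?sqrtr_ge0 //.
rewrite exprMn sqr_sqrtr // -expRM_natl real_normK ?num_real //.
by apply: le_trans xC _; rewrite mulrA [2 * _]mulrC divfK.
Unshelve. all: by end_near. Qed.

End decay.

(** * Vector norms *)

Section vector_norm.
Variables (R : realType) (n : nat) (N : 'cV[R[i]]_n -> R).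
Hypothesis hN : is_vnorm N.
Local Open Scope classical_set_scope.

Lemma vnorm_ge0 u : 0 <= N u. Proof. by case: hN. Qed.

Lemma vnormZ c u : N (c *: u) = cabs c * N u. Proof. by case: hN. Qed.

Lemma vnorm_triangle u v : N (u + v) <= N u + N v. Proof. by case: hN. Qed.

Lemma vnorm0 : N 0 = 0.
Proof. by rewrite -(scale0r (0 : 'cV_n)) vnormZ cabs0 mul0r. Qed.

Lemma vnorm_eq0 u : N u = 0 -> u = 0. Proof. by case: hN => _ + _ _; apply. Qed.

Lemma vnorm_gt0 u : u != 0 -> 0 < N u.
Proof.
by move=> u0; rewrite lt_def vnorm_ge0 andbT; apply: contra_neq u0 => /vnorm_eq0.
Qed.

Lemma vnormN u : N (- u) = N u.
Proof.
by rewrite -scaleN1r vnormZ /cabs normrN1 mul1r.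
Qed.

Lemma vnorm_dist u v : `|N u - N v| <= N (u - v).
Proof.
have le1 a b : N a - N b <= N (a - b).
  by rewrite lerBlDr -{1}(subrK b a) vnorm_triangle.
by rewrite ler_norml lerNl opprB le1 -(vnormN (u - v)) opprB le1.
Qed.

Lemma vnorm_sum (I : Type) (r : seq I) (P : pred I) (F : I -> 'cV[R[i]]_n) :
  N (\sum_(i <- r | P i) F i) <= \sum_(i <- r | P i) N (F i).
Proof.
apply: (big_ind2 (fun u a => N u <= a)) => [|u a v b ua vb|//].
  by rewrite vnorm0.
by apply: le_trans (vnorm_triangle _ _) _; exact: lerD.
Qed.

Lemma vnorm_le_sum u : N u <= \sum_k cabs (u k 0) * N (delta_mx k 0).
Proof.
rewrite {1}(matrix_sum_delta u); under eq_bigr do rewrite big_ord1.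
by apply: le_trans (vnorm_sum _ _ _) _; apply: ler_sum => k _; rewrite vnormZ.
Qed.

(** Identifies C^n with real rows of length 2 n, where compactness and [EVT_min_rV] are
    available. *)
Let cplx (z : 'rV[R]_(n + n)) : 'cV[R[i]]_n :=
  \col_k (z 0 (lshift n k) +i* z 0 (rshift n k))%C.

Let cplxZ a z : cplx (a *: z) = a%:C%C *: cplx z.
Proof.
apply/colP => k; rewrite !mxE; apply/eqP.
by rewrite eq_complex /= !mul0r subr0 addr0 !eqxx.
Qed.

Let rv_coord_le (z : 'rV[R]_(n + n)) k : `|z 0 k| <= `|z|.
Proof. by rewrite [leRHS]/Num.Def.normr /= mx_normrE (le_bigmax _ _ (0, k)). Qed.

Let cplx_continuous : continuous (fun z => N (cplx z)).
Proof.
(* A Lipschitz constant: 2 accounts for real and imaginary parts, and + 1 makes it positive even if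
   n = 0. *)
move=> z; pose M := 2 * (\sum_k N (delta_mx k 0)) + 1.
have S0 : 0 <= \sum_k N (delta_mx k 0 : 'cV_n).
  by apply: sumr_ge0 => k _; exact: vnorm_ge0.
have M0 : 0 < M by rewrite ltr_wpDl // mulr_ge0.
apply/(@cvgrPdist_lt _ _ _ (nbhs z) (nbhs_filter z)) => e e0.
apply/nbhs_ballP; exists (e / M) => [|y]; first by rewrite /= divr_gt0.
rewrite -ball_normE /= => yz.
apply: le_lt_trans (vnorm_dist _ _) _.
apply: le_lt_trans (_ : M * `|z - y| < e); last by rewrite mulrC -ltr_pdivlMr.
apply: le_trans (vnorm_le_sum _) _.
rewrite /M mulrDl mul1r ler_wpDr // mulrAC mulr_sumr ler_sum // => k _.
rewrite ler_wpM2r ?vnorm_ge0 // !mxE.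
apply: le_trans (cabs_le_Re_Im _) _; rewrite /= mulr_natl mulr2n lerD //.
  by have := rv_coord_le (z - y) (lshift n k); rewrite !mxE.
by have := rv_coord_le (z - y) (rshift n k); rewrite !mxE.
Qed.

(* Equivalence with the sup norm, by compactness of the unit sphere of R^(2n). *)
Lemma vnorm_coord_bound :
  exists2 c, 0 < c & forall (u : 'cV[R[i]]_n) k, cabs (u k 0) <= c * N u.
Proof.
pose S := [set z : 'rV[R]_(n + n) | `|z| = 1].
have cS : compact S.
  apply: bounded_closed_compact.
    by exists 1; split => // y y1 z /= ->; exact: ltW.
  have -> : S = (fun z : 'rV[R]_(n + n) => `|z|) @^-1` [set 1] by [].
  by apply: closed_comp => [z _|]; [exact: norm_continuous|exact: closed_eq].
pose coords (u : 'cV[R[i]]_n) : 'rV[R]_(n + n) :=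
  row_mx (\row_k complex.Re (u k 0)) (\row_k complex.Im (u k 0)).
have coordsK u : cplx (coords u) = u.
  apply/colP => k; rewrite mxE row_mxEl row_mxEr !mxE.
  by case: (u k 0).
have ucoord (u : 'cV[R[i]]_n) k : cabs (u k 0) <= 2 * `|coords u|.
  apply: le_trans (cabs_le_Re_Im _) _; rewrite mulr_natl mulr2n lerD //.
    by have := rv_coord_le (coords u) (lshift n k); rewrite row_mxEl mxE.
  by have := rv_coord_le (coords u) (rshift n k); rewrite row_mxEr mxE.
(* The sphere is empty only for n = 0, as any nonzero row can be normalized into it. *)
have [S0|/nonemptyPn S0] := pselect (S !=set0); last first.
  exists 1 => // u k; have [u0|u0] := eqVneq (coords u) 0.
    by rewrite (le_trans (ucoord u k)) // u0 normr0 mulr0 mul1r vnorm_ge0.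
  have : S (`|coords u|^-1 *: coords u).
    by rewrite /S /= normrZ normfV normr_id mulVf // normr_eq0.
  by rewrite S0.
have [z zS zmin] := EVT_min_rV S0 cS (continuous_subspaceT cplx_continuous).
rewrite inE /S /= in zS.
have m0 : 0 < N (cplx z).
  apply: vnorm_gt0; apply/eqP => z0; have : z = 0.
    apply/rowP => k; rewrite mxE; case: (split_ordP k) => j ->.
      by have /colP/(_ j) := z0; rewrite !mxE => -[].
    by have /colP/(_ j) := z0; rewrite !mxE => -[].
  by move=> z00; move: zS; rewrite z00 normr0 => /esym/eqP; rewrite oner_eq0.
(* By homogeneity, the sup norm of the coordinates is at most N u divided by the minimum of N on the
   sphere; 2 comes from [ucoord]. *)
exists (2 / N (cplx z)) => [|u k]; first by rewrite divr_gt0.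
apply: le_trans (ucoord u k) _; rewrite -mulrA ler_pM2l //.
have [u0|u0] := eqVneq (coords u) 0.
  by rewrite u0 normr0 mulr_ge0 ?vnorm_ge0 // invr_ge0 ltW.
rewrite ler_pdivlMl //.
have nu0 : 0 < `|coords u| by rewrite normr_gt0.
have /zmin : `|coords u|^-1 *: coords u \in S.
  by rewrite inE /S /= normrZ normfV normr_id mulVf // normr_eq0.
by rewrite cplxZ coordsK vnormZ cabs_real normfV normr_id ler_pdivlMl // mulrC.
Qed.

End vector_norm.

(** * The matrix exponential *)

Section matrix_exponential.
Variables (R : realType) (n : nat) (A : 'M[R]_n).
Local Open Scope classical_set_scope.

(** Presents each entry of e^{tA} as a power series in t, so that termwise differentiation
    applies. *)
Let coef i j : R^nat := fun k => (A ^+ k) i j / k`!%:R.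

Let expmxE t i j : expmx t A i j = limn (pseries (coef i j) t).
Proof.
rewrite mxE; congr (limn (series _)); apply/funext => k /=.
by rewrite /coef mulrC mulrA mulrAC.
Qed.

(** The induction is on absolute row sums, which are submultiplicative, rather than on single
    entries. *)
Let growth : exists2 M, 0 <= M & forall k i j, `|(A ^+ k) i j| <= M ^+ k.
Proof.
pose M := \sum_i \sum_j `|A i j| + 1.
have M0 : 0 <= \sum_i \sum_j `|A i j| by do 2!apply: sumr_ge0 => ? _.
exists M => [|k]; first by rewrite addr_ge0.
suff H i : \sum_j `|(A ^+ k) i j| <= M ^+ k.
  by move=> i j; apply: le_trans (H i); rewrite (bigD1 j) //= lerDl sumr_ge0.
elim: k i => [|k IH] i.
  rewrite expr0 (bigD1 i) //= big1 ?addr0 ?mxE ?eqxx ?normr1 // => j /negPf ji.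
  by rewrite mxE eq_sym ji normr0.
rewrite !exprS.
apply: le_trans (_ : \sum_l `|A i l| * M ^+ k <= _).
  apply: le_trans (_ : \sum_l \sum_j `|A i l| * `|(A ^+ k) l j| <= _).
    rewrite exchange_big /=; apply: ler_sum => j _; rewrite mxE.
    apply: le_trans (ler_norm_sum _ _ _) _.
    by apply: ler_sum => l _; rewrite normrM.
  by apply: ler_sum => l _; rewrite -mulr_sumr ler_wpM2l.
rewrite -mulr_suml ler_wpM2r ?exprn_ge0 ?addr_ge0 //.
rewrite ler_wpDr // [leRHS](bigD1 i) //= lerDl.
by do 2!apply: sumr_ge0 => ? _.
Qed.

Let cvg_coef i j t : cvgn (pseries (coef i j) t).
Proof.
have [M M0 HM] := growth.
apply: normed_cvg; apply: series_le_cvg (is_cvg_series_exp_coeff (M * `|t|)).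
- by move=> k /=.
- by move=> k; rewrite /exp_coeff /= divr_ge0 // exprn_ge0 // mulr_ge0.
- move=> k /=; rewrite /coef /exp_coeff /= !normrM normfV normrX normr_nat.
  by rewrite exprMn mulrAC ler_wpM2r ?invr_ge0 // ler_wpM2r ?exprn_ge0.
Qed.

Let diffs_coef i j :
  pseries_diffs (coef i j) = (fun k => (A ^+ k.+1) i j / k`!%:R).
Proof.
apply/funext => k; rewrite /pseries_diffs /coef factS natrM invfM.
by rewrite mulrCA mulVKf ?pnatr_eq0.
Qed.

Let pseries_sum (c : 'I_n -> R^nat) (a : 'I_n -> R) t :
  (forall l, cvgn (pseries (c l) t)) ->
  pseries (fun k => \sum_l a l * c l k) t @ \oo
    --> \sum_l a l * limn (pseries (c l) t).
Proof.
move=> cc.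
have -> : pseries (fun k => \sum_l a l * c l k) t
    = (fun m => \sum_l a l * pseries (c l) t m).
  apply/funext => m; rewrite /pseries /series /=.
  under eq_bigr do rewrite mulr_suml.
  rewrite exchange_big; apply: eq_bigr => l _; rewrite mulr_sumr.
  by apply: eq_bigr => k _; rewrite mulrA.
apply: cvg_big => [|l _]; first exact: add_continuous.
by apply: cvgMl_tmp; exact: cc.
Qed.

(** Splitting off one factor A expresses the differentiated series through the original ones, so
    convergence of the first and second formal derivatives reduces to [cvg_coef]. *)
Let pseries_diffsE i j :
  pseries_diffs (coef i j) = (fun k => \sum_l A i l * coef l j k).
Proof.
rewrite diffs_coef; apply/funext => k; rewrite exprS mxE mulr_suml.
by apply: eq_bigr => l _; rewrite mulrA.
Qed.

Lemma expmx_derive (t : R) i j :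
  is_derive t 1 (fun t => expmx t A i j) ((A *m expmx t A) i j).
Proof.
have -> : (fun t => expmx t A i j) = (fun t => limn (pseries (coef i j) t)).
  by apply/funext => s; exact: expmxE.
have -> : (A *m expmx t A) i j = limn (pseries (pseries_diffs (coef i j)) t).
  rewrite pseries_diffsE; apply/esym/cvg_lim => //; rewrite mxE.
  by under eq_bigr do rewrite expmxE; apply: pseries_sum => l; exact: cvg_coef.
have cvgd l K : cvgn (pseries (pseries_diffs (coef l j)) K).
  rewrite pseries_diffsE; apply/cvg_ex; eexists; apply: pseries_sum => m.
  exact: cvg_coef.
(* Termwise differentiation at t needs convergence of the series and its first two formal
   derivatives at a point of larger modulus. *)
apply: (@pseries_snd_diffs _ _ (`|t| + 1)) => //; last first.
  by rewrite [ltRHS]ger0_norm ?addr_ge0 // ltrDl.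
rewrite [pseries_diffs (coef i j)]pseries_diffsE.
have -> : pseries_diffs (fun k => \sum_l A i l * coef l j k)
    = (fun k => \sum_l A i l * pseries_diffs (coef l j) k).
  apply/funext => k; rewrite /pseries_diffs mulr_sumr.
  by apply: eq_bigr => l _; rewrite mulrCA.
by apply/cvg_ex; eexists; apply: pseries_sum => l; exact: cvgd.
Qed.

Lemma expmx0 : expmx 0 A = 1%:M.
Proof.
apply/matrixP => i j; rewrite expmxE; apply: cvg_lim => //.
(* The partial sum of index 0 is empty; all later ones equal the constant term. *)
rewrite -(cvg_shiftn 1) /=.
have -> : (fun m => pseries (coef i j) 0 (m + 1)%N) = cst ((1%:M : 'M[R]_n) i j).
  apply/funext => m; rewrite addn1 /pseries /series /= big_nat_recl // big1.
    by rewrite expr0 mulr1 addr0 /coef expr0 fact0 divr1.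
  by move=> k _; rewrite expr0n mulr0.
exact: cvg_cst.
Qed.

End matrix_exponential.

(** * The dominant oscillation *)

Section dominant_pair.
Variables (R : realType) (n : nat) (A : 'M[R]_n.+1) (l1 : R[i]).
Variables (w1 : 'rV[R[i]]_n.+1) (v1 : 'cV[R[i]]_n.+1).
Local Open Scope classical_set_scope.

Hypothesis Im_l1 : 0 < complex.Im l1.
Hypothesis mup_l1 : mup l1 (char_poly (cmx A)) = 1%N.
Hypothesis mup_l1J : mup (l1^*)%C (char_poly (cmx A)) = 1%N.
Hypothesis Re_le : forall mu, root (char_poly (cmx A)) mu ->
  complex.Re mu <= complex.Re l1.
Hypothesis Re_eq : forall mu, root (char_poly (cmx A)) mu ->
  complex.Re mu = complex.Re l1 -> mu = l1 \/ mu = (l1^*)%C.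
Hypothesis w1A : w1 *m cmx A = l1 *: w1.
Hypothesis Av1 : cmx A *m v1 = l1 *: v1.
Hypothesis w1v1 : (w1 *m v1) 0 0 = 1.

Let w1J := map_mx (@conjc R) w1.
Let v1J := map_mx (@conjc R) v1.

Let conj_cmx m k (M : 'M[R]_(m, k)) :
  map_mx (@conjc R) (map_mx (real_complex R) M) = map_mx (real_complex R) M.
Proof. by apply/matrixP => i j; rewrite !mxE conjc_real. Qed.

Let Av1J : cmx A *m v1J = (l1^*)%C *: v1J.
Proof. by rewrite /cmx -conj_cmx -map_mxM Av1 map_mxZ. Qed.

Let w1Jv1J : (w1J *m v1J) 0 0 = 1.
Proof. by rewrite -map_mxM mxE w1v1; exact: conjc1. Qed.

(** Left and right eigenvectors for distinct eigenvalues annihilate each other, and l1 differs from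
    its conjugate as Im l1 > 0. *)
Let w1v1J : (w1 *m v1J) 0 0 = 0.
Proof.
have : l1 * (w1 *m v1J) 0 0 = (l1^*)%C * (w1 *m v1J) 0 0.
  have := mulmxA w1 (cmx A) v1J; rewrite w1A Av1J -scalemxAl -scalemxAr.
  by move=> /matrixP /(_ 0 0); rewrite [LHS]mxE [RHS]mxE => ->.
move/eqP; rewrite -subr_eq0 -mulrBl mulf_eq0 => /orP[|/eqP //].
rewrite subr_eq0; case: l1 Im_l1 => a b /= b0; rewrite eq_complex /= eqxx /=.
by rewrite -subr_eq0 opprK -mulr2n mulrn_eq0 /= gt_eqF.
Qed.

Let c0 : R[i] := (complex.Re l1 - 1)%:C%C.

(* Moves the dominant pair l1, conj l1 to the real part Re l1 - 1, leaving the
   action on the kernel of w1 and conj w1 unchanged. *)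
Let B : 'M[R[i]]_n.+1 :=
  cmx A - (l1 - c0) *: (v1 *m w1) - ((l1^*)%C - c0) *: (v1J *m w1J).

(** Deflate twice: because w1 conj(v1) = 0, conj(v1) is still an eigenvector after the first
    deflation. *)
Let char_polyB :
  char_poly B * ('X - ((l1^*)%C)%:P) * ('X - l1%:P)
    = char_poly (cmx A) * ('X - c0%:P) ^+ 2.
Proof.
have B1v1J : (cmx A - (l1 - c0) *: (v1 *m w1)) *m v1J = (l1^*)%C *: v1J.
  rewrite mulmxBl Av1J -scalemxAl -mulmxA [w1 *m v1J]mx11_scalar w1v1J.
  by rewrite raddf0 mulmx0 scaler0 subr0.
rewrite (char_poly_deflation _ B1v1J w1Jv1J) mulrAC.
rewrite (char_poly_deflation _ Av1 w1v1) -mulrA.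
by rewrite !subKr expr2.
Qed.

(** A root other than c0 is an eigenvalue of A. If it were l1 or its conjugate, the left side of
    [char_polyB] would vanish there to order at least 2, the right side only to order 1. *)
Let rootB mu : root (char_poly B) mu -> complex.Re mu < complex.Re l1.
Proof.
move=> muB.
have : root (char_poly (cmx A) * ('X - c0%:P) ^+ 2) mu.
  by rewrite -char_polyB !rootM muB.
have nz M : char_poly M != 0 :> {poly R[i]} by rewrite monic_neq0 // char_poly_monic.
have xnz (z : R[i]) : 'X - z%:P != 0 by rewrite polyXsubC_eq0.
have [-> _|muc0] := eqVneq mu c0; first by rewrite /= ltrBlDr ltrDl.
rewrite rootM expr2 rootM orbb root_XsubC (negPf muc0) orbF => muA.
have := Re_le muA; rewrite le_eqVlt => /orP[/eqP /(Re_eq muA) mul1|//].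
have mupA : mup mu (char_poly (cmx A)) = 1%N by case: mul1 => ->.
have := mupMl (char_poly (cmx A)) (_ : ~~ root (('X - c0%:P) ^+ 2) mu).
rewrite -char_polyB -mulrA mupM ?mulf_neq0 // mupA expr2 rootM orbb root_XsubC.
move=> /(_ muc0) mup1.
have mup_gt0 q : q != 0 -> root q mu -> (0 < mup mu q)%N.
  by move=> q0 qmu; rewrite -XsubC_dvd // dvdp_XsubCl.
have hB : (0 < mup mu (char_poly B))%N by exact: mup_gt0.
have hl : (0 < mup mu (('X - ((l1^*)%C)%:P) * ('X - l1%:P)))%N.
  apply: mup_gt0; rewrite ?mulf_neq0 // rootM !root_XsubC.
  by case: mul1 => ->; rewrite eqxx ?orbT.
by have := leq_add hB hl; rewrite mup1.
Qed.

(** This is X(t) u: the spectral component of e^{tA} u on the pair l1, conj l1, with the growth e^{t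
    Re l1} removed. *)
Definition mode (u : 'cV[R]_n.+1) (t : R) : 'cV[R]_n.+1 :=
  \col_k (2 * complex.Re (expi (complex.Im l1 * t) * v1 k 0 * (w1 *m cvec u) 0 0)).

Let twoC : 2%:C%C = 2 :> R[i]. Proof. exact: rmorph_nat. Qed.

(** Writing 2 Re z as z plus its conjugate exposes eigenvectors, on which A and w1 act
    explicitly. *)
Let cvec_mode u t : cvec (mode u t) =
  (expi (complex.Im l1 * t) * (w1 *m cvec u) 0 0) *: v1
  + ((expi (complex.Im l1 * t) * (w1 *m cvec u) 0 0)^*)%C *: v1J.
Proof.
apply/colP => k; rewrite !mxE -rmorphM mulrAC.
by rewrite addcJ rmorphM /= twoC.
Qed.

Lemma w1_mode u t : (w1 *m cvec (mode u t)) 0 0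
  = expi (complex.Im l1 * t) * (w1 *m cvec u) 0 0.
Proof.
rewrite cvec_mode mulmxDr -!scalemxAr mxE [X in X + _]mxE [X in _ + X]mxE.
by rewrite w1v1 w1v1J mulr0 addr0 mulr1.
Qed.

(** The remainder G(t) u. *)
Let resid u t := expmx t A *m u - expR (complex.Re l1 * t) *: mode u t.

Let cvecB (u v : 'cV[R]_n.+1) : cvec (u - v) = cvec u - cvec v.
Proof. exact: map_mxB. Qed.

Let cvecM (u : 'cV[R]_n.+1) : cvec (A *m u) = cmx A *m cvec u.
Proof. exact: map_mxM. Qed.

Let A_mode u t k : (A *m mode u t) k 0 =
  2 * complex.Re (l1 * (expi (complex.Im l1 * t) * v1 k 0 * (w1 *m cvec u) 0 0)).
Proof.
apply: (@complexI R).
have -> : ((A *m mode u t) k 0)%:C%C = cvec (A *m mode u t) k 0 by rewrite [RHS]mxE.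
rewrite cvecM cvec_mode mulmxDr -!scalemxAr Av1 Av1J !scalerA.
rewrite mxE [X in X + _]mxE [X in _ + X]mxE [v1J k 0]mxE -!rmorphM.
rewrite addcJ rmorphM /= twoC. 
by congr (_ * (complex.Re _)%:C%C); ring.
Qed.

Let ode_resid u : ode_sol A (resid u).
Proof.
move=> t k.
pose z := v1 k 0 * (w1 *m cvec u) 0 0.
pose a := complex.Re l1; pose om := complex.Im l1.
(* Expanding the mode into real sines and cosines makes the real differentiation rules
   applicable. *)
have -> : (fun t => resid u t k 0) = (fun t => \sum_j u j 0 * expmx t A k j
    - 2 * expR (a * t) *
      (complex.Re z * cos (om * t) - complex.Im z * sin (om * t))).
  apply/funext => s; rewrite [LHS]mxE [X in X + _]mxE [X in _ + X]mxE [X in - X]mxE.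
  rewrite [mode _ _ _ _]mxE -[_ * v1 k 0 * _]mulrA -/z.
  congr (_ - _); first by apply: eq_bigr => j _; rewrite mulrC.
  by rewrite -/om /a; case: z => p q /=; ring.
have dsum : is_derive t 1 (fun t => \sum_j u j 0 * expmx t A k j)
    ((A *m (expmx t A *m u)) k 0).
  have -> : (fun t => \sum_j u j 0 * expmx t A k j)
      = \sum_j (fun t => u j 0 * expmx t A k j).
    by apply/funext => s; rewrite fct_sumE.
  rewrite mulmxA mxE; apply: is_derive_sum => j.
  have dE := expmx_derive A t k j.
  by apply: is_derive_eq; rewrite ?scaler0 ?addr0 [RHS]mulrC.
rewrite mulmxBr -scalemxAr mxE [X in _ + X]mxE [X in - X]mxE A_mode.
apply: is_derive_eq; rewrite -mulrA -/z -/om -/a /GRing.scale /=.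
have -> : l1 = (a +i* om)%C by rewrite /a /om; case: l1.
by case: z => p q /=; ring.
Qed.

Let w1_resid u t : 0 <= t -> w1 *m cvec (resid u t) = 0.
Proof.
move=> t0; rewrite [LHS]mx11_scalar -[RHS](raddf0 (@scalar_mx _ 1)).
congr (_%:M); apply: csq0P.
(* No forcing (p' = 0, C = 0) and zero initial value make the bound 0; with e = 1, the choice s = 2
   Re l1 + 2 turns the rate condition into an equality. *)
have := @ode_row_bound _ _ A _ (ode_resid u) w1 0 l1 (2 * complex.Re l1 + 2) 1 0.
have -> : csq ((w1 *m cvec (resid u 0)) 0 0) = 0.
  rewrite /resid mulr0 expR0 scale1r expmx0 mul1mx cvecB mulmxBr mxE.
  rewrite [X in _ + X]mxE w1_mode mulr0 /expi cos0 sin0.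
  by rewrite -[(1 +i* 0)%C]/(1 : R[i]) mul1r subrr /csq /= expr0n addr0.
rewrite !mul0r addr0 => H; apply: le_trans (H _ _ _ _ _ _ t0) _ => //.
- move=> s _; rewrite cvecM mulmxA w1A -scalemxAl mxE.
  by rewrite mul0mx [X in _ + X]mxE addr0.
- lra.
- by move=> s _; rewrite mul0mx mxE /csq /= expr0n addr0 mul0r.
Qed.

(** The residual is real, so conj(w1) kills it along with w1 and both deflation terms vanish. *)
Let B_resid u t : 0 <= t -> B *m cvec (resid u t) = cvec (A *m resid u t).
Proof.
move=> t0; have w0 := w1_resid u t0.
have wJ0 : w1J *m cvec (resid u t) = 0.
  by rewrite /cvec -conj_cmx -map_mxM w0 map_mx0.
rewrite /B !mulmxBl -!scalemxAl -!mulmxA w0 wJ0 !mulmx0 !scaler0 !subr0.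
by rewrite cvecM.
Qed.

Lemma expmx_mode_cvg u k :
  (expR (- complex.Re l1 * t) *: (expmx t A *m u) - mode u t) k 0
    @[t --> +oo] --> 0.
Proof.
have decay := ode_decay (ode_resid u) (@B_resid u) rootB k.
have -> // :
  (fun t => (expR (- complex.Re l1 * t) *: (expmx t A *m u) - mode u t) k 0)
  = (fun t => expR (- complex.Re l1 * t) * resid u t k 0).
apply/funext => t.
rewrite mxE [X in X + _]mxE [X in _ + X]mxE [resid _ _ _ _]mxE.
rewrite [X in _ * (_ + X)]mxE [X in _ * (_ - X)]mxE mulrBr mulrA.
by rewrite -expRD mulNr addNr expR0 mul1r.
Qed.

End dominant_pair.

(** * Asymptotic equivalence of norms *)

Lemma sum_cvg0 (R : realType) (n : nat) (f : 'I_n -> R -> R) :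
  (forall k, f k t @[t --> +oo] --> 0)%classic ->
  (\sum_k f k t @[t --> +oo] --> 0)%classic.
Proof.
move=> f0; have s0 : (0 : R) = \sum_(k < n) 0 by rewrite big1.
rewrite [X in (_ --> X)%classic]s0.
by apply: cvg_big => [|k _]; [exact: add_continuous|exact: f0].
Qed.

(** * The real induced matrix norm and bounded functionals *)

Section induced_norm.
Variables (R : realType) (n : nat) (N : 'cV[R[i]]_n -> R).
Hypothesis hN : is_vnorm N.
Local Open Scope classical_set_scope.

Lemma cvecZ (a : R) (u : 'cV[R]_n) : cvec (a *: u) = a%:C%C *: cvec u.
Proof. exact: map_mxZ. Qed.

Lemma rnormZ a u : rnorm N (a *: u) = `|a| * rnorm N u.
Proof. by rewrite /rnorm cvecZ (vnormZ hN) cabs_real. Qed.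

Lemma rnorm_dist u v : `|rnorm N u - rnorm N v| <= rnorm N (u - v).
Proof. by rewrite /rnorm [cvec (_ - _)]map_mxB; exact: vnorm_dist. Qed.

Lemma rnorm_le_sum u : rnorm N u <= \sum_k `|u k 0| * N (delta_mx k 0).
Proof.
apply: le_trans (vnorm_le_sum hN _) _.
by apply: ler_sum => k _; rewrite mxE cabs_real.
Qed.

Lemma rnorm_cvg0 (x : R -> 'cV[R]_n) :
  (forall k, x t k 0 @[t --> +oo] --> 0) -> rnorm N (x t) @[t --> +oo] --> 0.
Proof.
move=> x0.
have bnd : \sum_k `|x t k 0| * N (delta_mx k 0) @[t --> +oo] --> 0.
  apply: sum_cvg0 => k.
  rewrite -[X in _ --> X](mul0r (N (delta_mx k 0))); apply: cvgMr_tmp.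
  by rewrite -[X in _ --> X](@normr0 _ R); apply: cvg_norm; exact: x0.
apply: (squeeze_cvgr _ (cvg_cst 0) bnd); near=> t.
by rewrite (vnorm_ge0 hN) rnorm_le_sum.
Unshelve. all: by end_near. Qed.

Lemma row_bound (w : 'rV[R[i]]_n) :
  exists2 M, 0 < M & forall u : 'cV[R[i]]_n, cabs ((w *m u) 0 0) <= M * N u.
Proof.
have [c c0 cb] := vnorm_coord_bound hN.
have s0 : 0 <= \sum_k cabs (w 0 k) by apply: sumr_ge0 => k _; exact: cabs_ge0.
exists (\sum_k cabs (w 0 k) * c + 1) => [|u].
  by rewrite -mulr_suml ltr_wpDl // mulr_ge0 // ltW.
rewrite mulrDl mul1r ler_wpDr ?(vnorm_ge0 hN) // mxE mulr_suml.
apply: (big_ind2 (fun z b => cabs z <= b)) => [|z b z' b' zb zb'|k _].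
- by rewrite cabs0.
- by apply: le_trans (cabs_le_add _ _) _; exact: lerD.
- by rewrite cabsM -mulrA ler_wpM2l ?cabs_ge0.
Qed.

Lemma rownorm_gt0 (w : 'rV[R[i]]_n) (v : 'cV[R[i]]_n) :
  (w *m v) 0 0 != 0 -> 0 < rownorm N w.
Proof.
move=> wv.
have v0 : v != 0 by apply: contraNneq wv => ->; rewrite mulmx0 mxE.
have Nv := vnorm_gt0 hN v0.
have [M M0 HM] := row_bound w.
pose u := ((N v)^-1)%:C%C *: v.
have Nu : N u = 1.
  by rewrite (vnormZ hN) cabs_real gtr0_norm ?invr_gt0 // mulVf // gt_eqF.
apply: (@lt_le_trans _ _ (cabs ((w *m u) 0 0))).
  rewrite -scalemxAr mxE cabsM cabs_real gtr0_norm ?invr_gt0 //.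
  by rewrite mulr_gt0 ?invr_gt0 // lt_def cabs_ge0 cabs_eq0 wv.
(* [row_bound] makes the set bounded above; otherwise [sup] would be the default value 0. *)
apply: sup_ubound; last by exists u.
by exists M => _ [z /= Nz <-]; rewrite -[M]mulr1 -Nz.
Qed.

Let sphere_coord : exists2 c, 0 < c & forall (u : 'cV[R]_n) k,
  rnorm N u = 1 -> `|u k 0| <= c.
Proof.
have [c c0 cb] := vnorm_coord_bound hN; exists c => // u k u1.
by have := cb (cvec u) k; rewrite mxE cabs_real [N _]u1 mulr1.
Qed.

(** Reduces estimates that are uniform over the unit sphere to the finitely many columns of M. *)
Lemma rnorm_mulmx_le_sum (c : R) (M : 'M[R]_n) (u : 'cV[R]_n) :
  (forall k, `|u k 0| <= c) ->
  rnorm N (M *m u) <= c * \sum_k rnorm N (M *m delta_mx k 0).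
Proof.
move=> uc; rewrite {1}(matrix_sum_delta u) mulmx_sumr mulr_sumr.
apply: (big_ind2 (fun v b => rnorm N v <= b)) => [|v b v' b' vb vb'|k _].
- by rewrite /rnorm [cvec _]map_mx0 (vnorm0 hN).
- rewrite /rnorm [cvec _]map_mxD; apply: le_trans (vnorm_triangle hN _ _) _.
  exact: lerD.
- by rewrite big_ord1 -scalemxAr rnormZ ler_wpM2r ?(vnorm_ge0 hN).
Qed.

Lemma mnorm_ub (M : 'M[R]_n) u : rnorm N u = 1 -> rnorm N (M *m u) <= mnorm N M.
Proof.
move=> u1; apply: sup_ubound; last by exists u.
have [c c0 cb] := sphere_coord.
exists (c * \sum_k rnorm N (M *m delta_mx k 0)) => _ [v /= v1 <-].
by apply: rnorm_mulmx_le_sum => k; exact: cb.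
Qed.

(** A real unit vector makes the set in [mnorm] nonempty, as [sup_le_ub] requires. *)
Variable u0 : 'cV[R]_n.
Hypothesis u0_unit : rnorm N u0 = 1.

Lemma mnorm_le (M : 'M[R]_n) (K : R) :
  (forall u, rnorm N u = 1 -> rnorm N (M *m u) <= K) -> mnorm N M <= K.
Proof.
move=> H; apply: sup_le_ub; first by exists (rnorm N (M *m u0)), u0.
by move=> _ [u /= u1 <-]; exact: H.
Qed.

Lemma mnormZ (a : R) (M : 'M[R]_n) : 0 < a -> mnorm N (a *: M) = a * mnorm N M.
Proof.
move=> a0; apply/eqP; rewrite eq_le; apply/andP; split.
  apply: mnorm_le => u u1; rewrite -scalemxAl rnormZ gtr0_norm // ler_pM2l //.
  exact: mnorm_ub.
rewrite -ler_pdivlMl //; apply: mnorm_le => u u1; rewrite ler_pdivlMl //.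
by rewrite -[X in X * _]gtr0_norm // -rnormZ scalemxAl; exact: mnorm_ub.
Qed.

Lemma mnorm_dist (M M' : 'M[R]_n) K :
  (forall u, rnorm N u = 1 -> rnorm N ((M - M') *m u) <= K) ->
  `|mnorm N M - mnorm N M'| <= K.
Proof.
move=> H.
have H' u : rnorm N u = 1 -> `|rnorm N (M *m u) - rnorm N (M' *m u)| <= K.
  by move=> u1; apply: le_trans (rnorm_dist _ _) _; rewrite -mulmxBl; exact: H.
rewrite ler_norml lerNl opprB !lerBlDl; apply/andP; split.
  apply: mnorm_le => u u1; have := H' u u1; have := mnorm_ub M u1.
  by rewrite ler_norml => ? /andP[] ? ?; lra.
apply: mnorm_le => u u1; have := H' u u1; have := mnorm_ub M' u1.
by rewrite ler_norml => ? /andP[] ? ?; lra.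
Qed.

Lemma mnorm_cvg (M M' : R -> 'M[R]_n) :
  (forall k, rnorm N ((M t - M' t) *m delta_mx k 0) @[t --> +oo] --> 0) ->
  mnorm N (M t) - mnorm N (M' t) @[t --> +oo] --> 0.
Proof.
move=> MM'; have [c c0 cb] := sphere_coord.
apply: norm_cvg0.
have bnd : c * \sum_k rnorm N ((M t - M' t) *m delta_mx k 0) @[t --> +oo] --> 0.
  rewrite -[X in _ --> X](mulr0 c); apply: cvgMl_tmp.
  exact: sum_cvg0.
apply: (squeeze_cvgr _ (cvg_cst 0) bnd); near=> t.
rewrite normr_ge0 /=; apply: mnorm_dist => u u1.
by apply: rnorm_mulmx_le_sum => k; exact: cb.
Unshelve. all: by end_near. Qed.

End induced_norm.

Section asymptotics.
Variable R : realType.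
Local Open Scope classical_set_scope.
Implicit Types f g : R -> R.

(** As f / g - 1 = (f - g) / g, the lower bound m on g turns a vanishing absolute error into a
    vanishing relative one. *)
Lemma asym_equiv_sub f g (m : R) : 0 < m -> (forall t, m <= g t) ->
  f t - g t @[t --> +oo] --> 0 -> asym_equiv f g.
Proof.
move=> m0 gm fg; rewrite /asym_equiv.
have g0 t : 0 < g t := lt_le_trans m0 (gm t).
have -> : (fun t => f t / g t) = (fun t => (f t - g t) / g t + 1).
  by apply/funext => t; rewrite mulrBl divff ?gt_eqF // subrK.
rewrite -[X in _ --> X]add0r; apply: cvgD; last exact: cvg_cst.
apply: norm_cvg0.
have bnd : `|f t - g t| / m @[t --> +oo] --> 0.
  rewrite -[X in _ --> X](mul0r m^-1); apply: cvgMr_tmp.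
  by rewrite -[X in _ --> X](@normr0 _ R); exact: cvg_norm.
apply: (squeeze_cvgr _ (cvg_cst 0) bnd); near=> t.
rewrite normr_ge0 /= normrM ler_wpM2l // normfV gtr0_norm //.
by rewrite lef_pV2 ?posrE.
Unshelve. all: by end_near. Qed.

Lemma asym_equiv_div f g f' g' :
  asym_equiv f g -> asym_equiv f' g' ->
  asym_equiv (fun t => f t / f' t) (fun t => g t / g' t).
Proof.
rewrite /asym_equiv => fg fg'.
(* Inversion is total and involutive, so the identity holds even where a denominator vanishes. *)
have -> : (fun t => f t / f' t / (g t / g' t))
    = (fun t => f t / g t * (f' t / g' t)^-1).
  by apply/funext => t; rewrite !invfM !invrK; ring.
have H := cvgM fg (cvgV (oner_neq0 R) fg').
by rewrite invr1 mulr1 in H; exact: H.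
Qed.

End asymptotics.

(** * Polar forms and the two asymptotic equivalences *)

Lemma expiD (R : realType) (a b : R) : expi (a + b) = expi a * expi b.
Proof.
apply/eqP; rewrite eq_complex /= cosD sinD eqxx /=.
by apply/eqP; ring.
Qed.

Lemma Re_polar (R : realType) (r a : R) :
  complex.Re (r%:C%C * expi a) = r * cos a.
Proof. by rewrite /= mul0r subr0. Qed.

Unset Implicit Arguments.

Theorem theorem7 (R : realType) (n : nat) (N : 'cV[R[i]]_n -> R)
  (A : 'M[R]_n) (l1 : R[i]) (w1 : 'rV[R[i]]_n) (v1 : 'cV[R[i]]_n)
  (y0 z0h : 'cV[R]_n) (alpha beta : 'I_n -> R) (gy gz : R) :
  is_vnorm N ->
  (* Lambda_1 is complex: the eigenvalues of maximal real part are exactly the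
     simple pair l1, conj l1, with Im l1 > 0 *)
  root (char_poly (cmx A)) l1 ->
  0 < complex.Im l1 ->
  mup l1 (char_poly (cmx A)) = 1%N ->
  mup (l1^*)%C (char_poly (cmx A)) = 1%N ->
  (forall mu, root (char_poly (cmx A)) mu -> complex.Re mu <= complex.Re l1) ->
  (forall mu, root (char_poly (cmx A)) mu -> complex.Re mu = complex.Re l1 ->
     mu = l1 \/ mu = (l1^*)%C) ->
  (* left / right eigenvectors for l1, normalized by w1 v1 = 1 *)
  w1 != 0 -> w1 *m cmx A = l1 *: w1 ->
  v1 != 0 -> cmx A *m v1 = l1 *: v1 ->
  (w1 *m v1) 0 0 = 1 ->
  (* data *)
  rnorm N z0h = 1 ->
  (w1 *m cvec y0) 0 0 != 0 ->
  (w1 *m cvec z0h) 0 0 != 0 ->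
  let om := complex.Im l1 in
  let y0h := (rnorm N y0)^-1 *: y0 in
  let vh := ((N v1)^-1)%:C%C *: v1 in
  let wh := ((rownorm N w1)^-1)%:C%C *: w1 in
  (* phases alpha_k, beta_l, gamma_1(\hat y0), gamma_1(\hat z0) *)
  (forall k, vh k 0 = (cabs (vh k 0))%:C%C * expi (alpha k)) ->
  (forall l, wh 0 l = (cabs (wh 0 l))%:C%C * expi (beta l)) ->
  (wh *m cvec y0h) 0 0 = (cabs ((wh *m cvec y0h) 0 0))%:C%C * expi gy ->
  (wh *m cvec z0h) 0 0 = (cabs ((wh *m cvec z0h) 0 0))%:C%C * expi gz ->
  let K1 := fun t => rnorm N (expmx t A *m z0h) / rnorm N (expmx t A *m y0h) in
  let K2 := fun t => mnorm N (expmx t A) / rnorm N (expmx t A *m y0h) in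
  let OSF1 := cabs ((wh *m cvec z0h) 0 0) / cabs ((wh *m cvec y0h) 0 0) in
  let OSF2 := 1 / cabs ((wh *m cvec y0h) 0 0) in
  let OT1 := fun t => rnorm N (Theta_vec om vh alpha gz t)
                      / rnorm N (Theta_vec om vh alpha gy t) in
  let OT2 := fun t => mnorm N (Theta_mx om vh wh alpha beta t)
                      / rnorm N (Theta_vec om vh alpha gy t) in
  asym_equiv K1 (fun t => OSF1 * OT1 t) /\ asym_equiv K2 (fun t => OSF2 * OT2 t).
Proof.
move=> hN _ Im_l1 mup1 mup1J Re_le Re_eq _ w1A v1n0 Av1 w1v1 z1 wy wz om y0h vh wh.
move=> alphaE betaE gyE gzE K1 K2 OSF1 OSF2 OT1 OT2.
(* For n = 0 the product w1 v1 is an empty sum and cannot be 1. *)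
case: n => [|n'] in N A w1 v1 y0 z0h alpha beta hN mup1 mup1J Re_le Re_eq w1A
  v1n0 Av1 w1v1 z1 wy wz y0h vh wh alphaE betaE gyE gzE K1 K2 OSF1 OSF2 OT1 OT2 *.
  by move: w1v1; rewrite mxE big_ord0 => /esym/eqP; rewrite oner_eq0.
pose a := complex.Re l1.
pose rho := rownorm N w1.
pose e t := expR (- a * t).
pose x u t := mode l1 w1 v1 u t.
have rho0 : 0 < rho by apply: (rownorm_gt0 hN (v := v1)); rewrite w1v1 oner_neq0.
have Nv0 : 0 < N v1 := vnorm_gt0 hN v1n0.
(* The 2 comes from [mode]; N v1 and rho undo the normalizations of v1 and w1. *)
pose kappa := 2 * N v1 * rho.
have kappa0 : 0 < kappa by rewrite !mulr_gt0.
have w1E : w1 = rho%:C%C *: wh.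
  by rewrite scalerA -rmorphM divff ?gt_eqF // scale1r.
have v1E : v1 = (N v1)%:C%C *: vh.
  by rewrite scalerA -rmorphM divff ?gt_eqF // scale1r.
have mode_limit := expmx_mode_cvg Im_l1 mup1 mup1J Re_le Re_eq w1A Av1 w1v1.
have rnorm_e u t :
    rnorm N (expmx t A *m u) = (e t)^-1 * rnorm N (e t *: (expmx t A *m u)).
  by rewrite (rnormZ hN) gtr0_norm ?expR_gt0 // mulKf // gt_eqF ?expR_gt0.
have [M M0 HM] := row_bound hN w1.
(* A bound uniform in t: w1 has modulus |w1 u| on the mode and is bounded by M times the norm. *)
have low u t : cabs ((w1 *m cvec u) 0 0) / M <= rnorm N (x u t).
  rewrite ler_pdivrMr // mulrC; apply: le_trans (HM _).
  by rewrite (w1_mode Im_l1 w1A Av1 w1v1) cabsM cabs_expi mul1r.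
have vec_equiv u : (w1 *m cvec u) 0 0 != 0 ->
    asym_equiv (fun t => rnorm N (e t *: (expmx t A *m u)))
      (fun t => rnorm N (x u t)).
  move=> wu; apply: (@asym_equiv_sub _ _ _ (cabs ((w1 *m cvec u) 0 0) / M)) => //.
    by rewrite divr_gt0 // lt_def cabs_ge0 cabs_eq0 wu.
  apply: norm_cvg0.
  apply: (squeeze_cvgr _ (cvg_cst 0) (rnorm_cvg0 hN (mode_limit u))); near=> t.
  by rewrite normr_ge0 /=; exact: rnorm_dist.
have xE u g t : (wh *m cvec u) 0 0 = (cabs ((wh *m cvec u) 0 0))%:C%C * expi g ->
    x u t = (kappa * cabs ((wh *m cvec u) 0 0)) *: Theta_vec om vh alpha g t.
  move=> gE; apply/colP => k; rewrite [LHS]mxE [RHS]mxE [X in _ = _ * X]mxE.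
  rewrite {1}w1E {1}v1E -scalemxAl [X in _ * X * _]mxE [X in _ * _ * X]mxE.
  have ak := alphaE k; set r1 := cabs (vh k 0) in ak *; set r2 := cabs _ in gE *.
  rewrite gE ak.
  (* The phases of the three complex factors add up to the argument of the cosine in [Theta_vec]. *)
  have -> : expi (complex.Im l1 * t) * ((N v1)%:C%C * (r1%:C%C * expi (alpha k)))
      * (rho%:C%C * (r2%:C%C * expi g))
      = (N v1 * rho * r1 * r2)%:C%C * expi (om * t + alpha k + g).
    by rewrite !expiD !rmorphM /= /om; ring.
  by rewrite Re_polar /kappa; ring.
have wy0h : (w1 *m cvec y0h) 0 0 != 0.
  rewrite /y0h cvecZ -scalemxAr mxE mulf_neq0 // eq_complex /= eqxx andbT invr_eq0.
  apply: contra_neq wy => /(vnorm_eq0 hN) ->.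
  by rewrite mulmx0 mxE.
have nx u g t : (wh *m cvec u) 0 0 = (cabs ((wh *m cvec u) 0 0))%:C%C * expi g ->
    rnorm N (x u t)
      = kappa * cabs ((wh *m cvec u) 0 0) * rnorm N (Theta_vec om vh alpha g t).
  move=> /xE ->; rewrite (rnormZ hN) ger0_norm // mulr_ge0 ?cabs_ge0 //.
  exact: ltW.
have e0 t : e t != 0 by rewrite gt_eqF // expR_gt0.
split.
  (* The factor e^{- t Re l1} is inserted in numerator and denominator; below, kappa cancels
     likewise. *)
  have -> : K1 = (fun t => rnorm N (e t *: (expmx t A *m z0h))
                           / rnorm N (e t *: (expmx t A *m y0h))).
    apply/funext => t; rewrite /K1 !rnorm_e invfM invrK mulrACA.
    by rewrite mulVf // mul1r.
  have -> : (fun t => OSF1 * OT1 t) = (fun t => rnorm N (x z0h t) / rnorm N (x y0h t)).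
    apply/funext => t; rewrite (nx _ _ _ gzE) (nx _ _ _ gyE) /OSF1 /OT1 mulf_div.
    by rewrite -!(mulrA kappa (cabs _)) -[RHS]mulf_div divff ?mul1r // gt_eqF.
  by apply: asym_equiv_div; exact: vec_equiv.
(* The matrix of the linear map u -> [mode] u t, to which the induced norm applies. *)
pose X t := \matrix_(k, l)
  (2 * complex.Re (expi (om * t) * v1 k 0 * w1 0 l)) : 'M[R]_n'.+1.
have Xmode t u : X t *m u = x u t.
  apply/colP => k; rewrite [LHS]mxE [RHS]mxE [(w1 *m _) 0 0]mxE mulr_sumr Re_sum.
  rewrite mulr_sumr; apply: eq_bigr => l _.
  by rewrite [X t k l]mxE [cvec u l 0]mxE [in RHS]mulrA ReMr [RHS]mulrA.
have XE t : X t = kappa *: Theta_mx om vh wh alpha beta t.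
  apply/matrixP => k l; rewrite [LHS]mxE [RHS]mxE [X in _ = _ * X]mxE.
  rewrite {1}w1E {1}v1E [X in _ * X * _]mxE [X in _ * _ * X]mxE.
  have ak := alphaE k; have bl := betaE l.
  set r1 := cabs (vh k 0) in ak *; set r2 := cabs (wh 0 l) in bl *.
  rewrite ak bl.
  have -> : expi (om * t) * ((N v1)%:C%C * (r1%:C%C * expi (alpha k)))
      * (rho%:C%C * (r2%:C%C * expi (beta l)))
      = (N v1 * rho * r1 * r2)%:C%C * expi (om * t + alpha k + beta l).
    by rewrite !expiD !rmorphM /=; ring.
  by rewrite Re_polar /kappa; ring.
have mnorm_equiv :
    asym_equiv (fun t => mnorm N (e t *: expmx t A)) (fun t => mnorm N (X t)).
  (* The unit vector [z0h], on which w1 does not vanish, bounds the norm of X(t) from below; the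
     columns converge as modes of basis vectors. *)
  apply: (@asym_equiv_sub _ _ _ (cabs ((w1 *m cvec z0h) 0 0) / M)) => [|t|].
  - by rewrite divr_gt0 // lt_def cabs_ge0 cabs_eq0 wz.
  - by apply: le_trans (low z0h t) _; rewrite -Xmode; exact: mnorm_ub.
  - apply: (mnorm_cvg hN z1) => k; apply: (rnorm_cvg0 hN) => i.
    have := mode_limit (delta_mx k 0) i.
    by under eq_fun do rewrite scalemxAl -[mode _ _ _ _ _]Xmode -mulmxBl.
have -> : K2 = (fun t => mnorm N (e t *: expmx t A)
                         / rnorm N (e t *: (expmx t A *m y0h))).
  apply/funext => t; rewrite /K2 rnorm_e (mnormZ hN z1) ?expR_gt0 // invfM invrK.
  by rewrite mulrA [_ * e t]mulrC.
have -> : (fun t => OSF2 * OT2 t) = (fun t => mnorm N (X t) / rnorm N (x y0h t)).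
  apply/funext => t; rewrite (nx _ _ _ gyE) XE (mnormZ hN z1) // /OSF2 /OT2 mulf_div.
  by rewrite -(mulrA kappa (cabs _)) -[RHS]mulf_div divff ?mul1r // gt_eqF.
by apply: asym_equiv_div => //; exact: vec_equiv.
Unshelve. all: by end_near.
Qed.
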